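(* If $q\in\{9,10,\dots,15\}$, then $\operatorname{achr}(K_6\square K_q)=2q+6$.
   Context: For a finite simple graph $G$, $\operatorname{achr}(G)$ (the achromatic number) is the maximum number of colours in a proper vertex colouring of $G$ that is complete, i.e. every pair of distinct colours appears on the two ends of some edge. $K_6\square K_q$ is the Cartesian product of the complete graphs $K_6$ and $K_q$ (vertex set $[1,6]\times[1,q]$, two vertices adjacent iff they agree in exactly one coordinate). *)

(* Defs.v *)
From mathcomp Require Import all_boot.

Set Implicit Arguments.
Unset Strict Implicit.
Unset Printing Implicit Defensive.

Record sgraph := SGraph {
  vertex :> finType;
  adj : rel vertex;
  adj_sym : symmetric adj;
  adj_irrefl : irreflexive adj
}.

Section Colouring.
Variables (G : sgraph) (k : nat).
Implicit Type c : {ffun G -> 'I_k}.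

Definition proper_colouring c : bool :=
  [forall x : G, forall y : G, adj x y ==> (c x != c y)].

Definition all_colours_used c : bool :=
  [forall i : 'I_k, exists x : G, c x == i].

Definition complete_colouring c : bool :=
  [forall i : 'I_k, forall j : 'I_k, (i != j) ==>
     [exists x : G, exists y : G, [&& adj x y, c x == i & c y == j]]].

End Colouring.

(* A colouring using all of its k colours has k <= #|G|, so the bound on k
   excludes nothing. *)
Definition achr (G : sgraph) : nat :=
  \max_(k < #|G|.+1 | [exists c : {ffun G -> 'I_k},
      [&& proper_colouring c, all_colours_used c & complete_colouring c]]) k.

Section CompleteGraph.
Variable n : nat.

Definition complete_adj : rel 'I_n := fun i j => i != j.

Lemma complete_adj_sym : symmetric complete_adj.
Proof. by move=> i j; rewrite /complete_adj eq_sym. Qed.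

Lemma complete_adj_irrefl : irreflexive complete_adj.
Proof. by move=> i; rewrite /complete_adj eqxx. Qed.

Definition complete_graph : sgraph :=
  SGraph complete_adj_sym complete_adj_irrefl.

End CompleteGraph.

Section CartesianProduct.
Variables G H : sgraph.

Definition box_adj : rel (G * H)%type := fun u v =>
  (u.1 == v.1) && adj u.2 v.2 || adj u.1 v.1 && (u.2 == v.2).

Lemma box_adj_sym : symmetric box_adj.
Proof.
move=> u v; rewrite /box_adj (adj_sym u.1) (adj_sym u.2).
by rewrite (eq_sym u.1) (eq_sym u.2).
Qed.

Lemma box_adj_irrefl : irreflexive box_adj.
Proof. by move=> u; rewrite /box_adj !adj_irrefl andbF. Qed.

Definition box_graph : sgraph := SGraph box_adj_sym box_adj_irrefl.

End CartesianProduct.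

(* Main.v *)
Require Import Defs.
From mathcomp Require Import all_boot zify.

Set Implicit Arguments.
Unset Strict Implicit.
Unset Printing Implicit Defensive.

(** Upper bound. The vertices sharing a row or a column with a colour class of
    size [f] number [6q - (6 - f)(q - f)] and must carry all [k] colours. If
    [k >= 2q + 7], this rules out classes of size 1, and it shows that two
    classes of size 2 never occupy the same two rows; hence at most
    [binomial(6, 2) = 15] classes have size 2, whereas counting the [6q]
    vertices requires at least 21 of them.

    Lower bound. Split the rows into two halves of three, and put [q = m + 6].
    The first [m] columns carry [m] colours occupying all the top rows and [m]
    colours occupying all the bottom rows, arranged so that any top colour meets
    any bottom colour in a column; this needs [m^2 <= 9 m], i.e. [q <= 15]. The
    last six columns are indexed by the permutations [s] of three points, and
    carry 18 colours [(i, j, e)] of size 2, with [e] a sign: in the column [s],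
    the cell in the top row [i] gets [(i, s i, sgn s)], and the cell in the
    bottom row [s i] gets [(i, s i, - sgn s)]. Since exactly one permutation
    extends [i -> j, i' -> j'], colours with no common row meet in a column. *)

Section ColourClasses.
Variables (n q k : nat).
Let G := box_graph (complete_graph n) (complete_graph q).
Variable c : {ffun G -> 'I_k}.

Definition colour_class (i : 'I_k) : {set G} := [set x | c x == i].

Definition class_rows (i : 'I_k) : {set 'I_n} :=
  [set (x : 'I_n * 'I_q).1 | x in colour_class i].

Definition class_columns (i : 'I_k) : {set 'I_q} :=
  [set (x : 'I_n * 'I_q).2 | x in colour_class i].

Definition class_cross (i : 'I_k) : {set G} :=
  ~: setX (~: class_rows i) (~: class_columns i).

Lemma in_class_cross i (x : G) :
  (x \in class_cross i) = (x.1 \in class_rows i) || (x.2 \in class_columns i).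
Proof. by rewrite !inE -negb_or negbK. Qed.

Lemma sum_card_colour_class (U : {set G}) :
  \sum_i #|U :&: colour_class i| = #|U|.
Proof.
rewrite -sum1_card (partition_big c xpredT) //=.
by apply: eq_bigr => i _; rewrite -sum1_card; apply: eq_bigl => x; rewrite !inE.
Qed.

Lemma subset_class_cross i j :
  class_rows j \subset class_rows i -> colour_class j \subset class_cross i.
Proof.
move=> /subsetP sji; apply/subsetP => x xj; rewrite in_class_cross sji //.
by apply/imsetP; exists x.
Qed.

Hypothesis proper_c : proper_colouring c.

Lemma proper_colour_class i :
  {in colour_class i &, injective (fun x : 'I_n * 'I_q => x.1)} /\
  {in colour_class i &, injective (fun x : 'I_n * 'I_q => x.2)}.
Proof.
have adjF x y : x \in colour_class i -> y \in colour_class i -> ~~ adj x y.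
  rewrite !inE => /eqP cx /eqP cy; apply/negP => xy.
  have /forallP/(_ x)/forallP/(_ y) := proper_c.
  by rewrite xy cx cy eqxx.
split=> -[a b] [a' b'] /adjF h /h; rewrite /= /box_adj /= /complete_adj.
  by move=> + aa; rewrite aa eqxx orbF negbK => /eqP ->.
by move=> + bb; rewrite bb eqxx andbF andbT negbK => /eqP ->.
Qed.

Lemma card_class_rows i : #|class_rows i| = #|colour_class i|.
Proof. by rewrite card_in_imset //; case: (proper_colour_class i). Qed.

Lemma card_class_columns i : #|class_columns i| = #|colour_class i|.
Proof. by rewrite card_in_imset //; case: (proper_colour_class i). Qed.

Lemma card_class_cross i :
  #|class_cross i| = n * q - (n - #|colour_class i|) * (q - #|colour_class i|).
Proof.
rewrite [LHS]cardsCs setCK cardsX card_prod !card_ord.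
rewrite [#|~: class_rows i|]cardsCs [#|~: class_columns i|]cardsCs !setCK.
by rewrite !card_ord card_class_rows card_class_columns.
Qed.

(** Only classes of size 2 fall short of three cells, each by one, and they occupy distinct pairs of
    rows, so the total shortfall is at most ['C(n, 2)]. *)
Lemma three_colours_le :
  (forall i, 1 < #|colour_class i|) ->
  {in [set i | #|colour_class i| == 2] &, injective class_rows} ->
  3 * k <= n * q + 'C(n, 2).
Proof.
move=> gt1 inj; set P := [set i | _] in inj.
have : #|P| <= 'C(n, 2).
  rewrite -(card_in_imset inj) -[X in 'C(X, 2)]card_ord -cardsT -cards_draws.
  apply: subset_leq_card; apply/subsetP => _ /imsetP[i + ->].
  by rewrite !inE subsetT card_class_rows.
suff : 3 * k <= n * q + #|P| by lia.
have /eqP := sum_card_colour_class [set: G].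
rewrite cardsT card_prod !card_ord => /eqP <-.
rewrite -sum1_card [X in _ + X]big_mkcond -big_split /=.
rewrite -[X in 3 * X]card_ord mulnC -sum_nat_const.
apply: leq_sum => i _; rewrite setTI inE.
by have := gt1 i; case: #|_| => [|[|[|[]]]].
Qed.

Hypotheses (used_c : all_colours_used c) (complete_c : complete_colouring c).

Lemma colour_class_gt0 i : 0 < #|colour_class i|.
Proof.
have /forallP/(_ i)/existsP[x xi] := used_c.
by apply/card_gt0P; exists x; rewrite inE.
Qed.

Lemma class_cross_meets i j : 0 < #|class_cross i :&: colour_class j|.
Proof.
have [<-|ij] := eqVneq i j.
  by rewrite (setIidPr (subset_class_cross _)) ?colour_class_gt0.
have /forallP/(_ i)/forallP/(_ j) := complete_c; rewrite ij /=.
move=> /existsP[x /existsP[y /and3P[xy cx cy]]].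
apply/card_gt0P; exists y; rewrite in_setI in_class_cross inE cy andbT.
have xi : x \in colour_class i by rewrite inE.
case/orP: xy => [/andP[/eqP xy _]|/andP[_ /eqP xy]]; rewrite -xy.
  by apply/orP; left; apply/imsetP; exists x.
by apply/orP; right; apply/imsetP; exists x.
Qed.

(** The cross contains the whole class of [i] and a cell of each of the other [k - 1] colours. *)
Lemma colours_le_class_cross i : k + #|colour_class i| <= #|class_cross i|.+1.
Proof.
rewrite -(sum_card_colour_class (class_cross i)) (bigD1 i) //=.
rewrite (setIidPr (subset_class_cross _)) // -addnS [k + _]addnC leq_add2l.
rewrite -[X in X <= _]card_ord -sum1_card (bigD1 i) //= ltnS.
by apply: leq_sum => j _; apply: class_cross_meets.
Qed.

Lemma colours_le_class_cross2 i j :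
  j != i -> class_rows j \subset class_rows i ->
  k + #|colour_class i| + #|colour_class j| <= #|class_cross i|.+2.
Proof.
move=> ji sji; rewrite -(sum_card_colour_class (class_cross i)) (bigD1 i) //= (bigD1 j) //=.
rewrite !(setIidPr (subset_class_cross _)) //.
rewrite -addnA addnC addnA -!addnS leq_add2l.
rewrite -[X in X <= _]card_ord -sum1_card (bigD1 i) //= (bigD1 j) //= !ltnS.
by apply: leq_sum => l _; apply: class_cross_meets.
Qed.

End ColourClasses.

Lemma complete_colouring_box6_le (q k : nat)
    (c : {ffun box_graph (complete_graph 6) (complete_graph q) -> 'I_k}) :
  1 < q -> proper_colouring c -> all_colours_used c -> complete_colouring c ->
  k <= 2 * q + 6.
Proof.
move=> q_gt1 pc uc cc; rewrite leqNgt; apply/negP => k_gt.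
have := three_colours_le pc.
have -> : 'C(6, 2) = 15 by [].
suff [gt1 inj] : (forall i, 1 < #|colour_class c i|) /\
  {in [set i | #|colour_class c i| == 2] &, injective (class_rows c)}.
  by move/(_ gt1 inj); lia.
split=> [i|i j].
  (* The cross of a single cell has [q + 5] cells, which would force [k <= q + 5]. *)
  have := colours_le_class_cross uc cc i; have := colour_class_gt0 uc i.
  by rewrite card_class_cross //; case: #|_| => [|[|]] //; nia.
rewrite !inE => /eqP i2 /eqP j2 rows; apply/eqP; case: eqVneq => // ij.
(* The cross has [6q - 4(q - 2) = 2q + 8] cells, so [k + 4 <= 2q + 10]. *)
have := colours_le_class_cross2 uc cc ij.
by rewrite rows subxx card_class_cross // i2 j2 => /(_ isT); nia.
Qed.

(* Colours [0 .. m-1] are the top ones, [m .. 2m-1] the bottom ones, and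
   [2m + 6 i + 2 j + e] encodes [(i, j, e)]. A top and a bottom colour meet as
   soon as their difference is [minn (3 * r') (m - 3 + r') - r] modulo [m] for
   some [r, r' < 3]. The permutations of [Z/3] are [i -> p + i] and
   [i -> p - i = p + 2 i]. *)
Definition box6_colour (m row col : nat) : nat :=
  let r := row %% 3 in
  if col < m then
    if row < 3 then (col + r) %% m
    else m + (col + minn (3 * r) (m - 3 + r)) %% m
  else
    let p := (col - m) %% 3 in
    let e := (col - m) %/ 3 in
    if row < 3 then 2 * m + 6 * r + 2 * ((p + e.+1 * r) %% 3) + e
    else 2 * m + 6 * ((if e == 0 then 2 * p + r else p + 2 * r) %% 3) + 2 * r
         + (1 - e).

Definition cell_adj (x y : nat * nat) : bool :=
  (x.1 == y.1) && (x.2 != y.2) || (x.1 != y.1) && (x.2 == y.2).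

Definition grid (n q : nat) : seq (nat * nat) :=
  [seq (i, j) | i <- iota 0 n, j <- iota 0 q].

(** The nested [if]s stand for conjunctions: under call-by-value [vm_compute], [&&] would run the
    inner search for every [x]. *)
Definition complete_table (n q k : nat) (f : nat -> nat -> nat) : bool :=
  let cells := grid n q in
  let col (x : nat * nat) := f x.1 x.2 in
  [&& all (fun x => col x < k) cells,
      all (fun x => all (fun y => cell_adj x y ==> (col x != col y)) cells) cells,
      all (fun i => has (fun x => col x == i) cells) (iota 0 k) &
      all (fun i => all (fun j => (i != j) ==>
         has (fun x => if col x == i then
            has (fun y => if col y == j then cell_adj x y else false) cells
            else false) cells) (iota 0 k)) (iota 0 k)].

Lemma complete_table_colouring (n q k : nat) (f : nat -> nat -> nat) :
  complete_table n q k f ->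
  exists c : {ffun box_graph (complete_graph n) (complete_graph q) -> 'I_k},
    [&& proper_colouring c, all_colours_used c & complete_colouring c].
Proof.
set G := box_graph _ _.
pose cell (v : 'I_n * 'I_q) := (v.1 : nat, v.2 : nat).
have cell_grid v : cell v \in grid n q.
  by apply/allpairsP; exists (cell v); rewrite !mem_iota /= !ltn_ord.
have grid_cell x : x \in grid n q -> exists v, x = cell v.
  move=> /allpairsP[y [+ + ->]]; rewrite !mem_iota /= !add0n => h1 h2.
  by exists (Ordinal h1, Ordinal h2).
have cell_adjE (u v : G) : adj u v = cell_adj (cell u) (cell v) by [].
case/and4P=> /allP lt_k /allP proper /allP used /allP complete.
exists [ffun v : G => Ordinal (lt_k _ (cell_grid v))].
apply/and3P; split.
- apply/forallP => u; apply/forallP => v; rewrite !ffunE cell_adjE.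
  by have /allP/(_ _ (cell_grid v)) := proper _ (cell_grid u).
- apply/forallP => i; have := used i; rewrite mem_iota /= ltn_ord => /(_ isT).
  case/hasP => _ /grid_cell[v ->] fv.
  by apply/existsP; exists v; rewrite ffunE.
apply/forallP => i; apply/forallP => j; apply/implyP => ij.
have := complete i; rewrite mem_iota /= ltn_ord => /(_ isT)/allP/(_ j).
rewrite mem_iota /= ltn_ord => /(_ isT)/implyP/(_ ij).
case/hasP => _ /grid_cell[u ->]; case: ifP => // fu.
case/hasP => _ /grid_cell[v ->]; case: ifP => // fv uv.
apply/existsP; exists u; apply/existsP; exists v.
by rewrite !ffunE; apply/and3P.
Qed.

Lemma complete_table_box6 (q : nat) :
  9 <= q <= 15 -> complete_table 6 q (2 * q + 6) (box6_colour (q - 6)).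
Proof.
move=> hq; have : q \in iota 9 7 by rewrite mem_iota; lia.
by move: q {hq}; apply/allP; vm_compute.
Qed.

Theorem theorem14 (q : nat) (hq : 9 <= q <= 15) :
  achr (box_graph (complete_graph 6) (complete_graph q)) = 2 * q + 6.
Proof.
apply/eqP; rewrite eqn_leq; apply/andP; split.
  apply/bigmax_leqP => k /existsP[c /and3P[pc uc cc]].
  by apply: complete_colouring_box6_le cc => //; lia.
set G := box_graph _ _.
have ltG : 2 * q + 6 < #|G|.+1 by rewrite card_prod !card_ord; lia.
apply: (@bigmax_sup _ (Ordinal ltG)) => //.
have [c hc] := complete_table_colouring (complete_table_box6 hq).
by apply/existsP; exists c.
Qed.
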